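(* Let $G=(V,E)$ be a finite simple graph, let $S$ be a zero forcing set of $G$ with a forcing chain $S'$ and variance polynomial vector $\mathbf{V}^{S'}(t)$, and let $\varepsilon\ge0$. Let $\mathbf{A}\in\mathcal{S}_{\mathbb{R}}(G)$ with $\kappa'=\kappa'(\mathbf{A})$, and let $\mathbf{x}\in\mathbb{R}^V$ with $\mathbf{A}\mathbf{x}=\mathbf{0}$. Suppose that for each $i\in S$, $\mathbf{x}'_i$ is a real random variable with mean $\mathbf{x}_i$ and variance $\varepsilon$, and that the $\mathbf{x}'_i$, $i\in S$, are mutually independent. Then, using only $\mathbf{x}'_S$ (together with $\mathbf{A}$), a vector $\hat{\mathbf{x}}$ can be computed (i.e., $\hat{\mathbf{x}}=\Phi(\mathbf{x}'_S)$ for a deterministic map $\Phi:\mathbb{R}^S\to\mathbb{R}^V$ depending only on $\mathbf{A}$, $S$, $S'$) such that for every $i\in V$ the random quantity $\mathbf{x}_i-\hat{\mathbf{x}}_i$ has mean $0$ and variance at most $\mathbf{V}^{S'}_i(\kappa')\,\varepsilon$.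
   Context: Zero forcing: starting with the vertices of $S$ colored, if a colored vertex $u$ has exactly one uncolored neighbor $v$, then $u$ may force $v$; $S$ is a zero forcing set if repeated forcing colors all vertices. A forcing chain $S'$ of $S$ is a record of a valid forcing process from $S$ coloring all of $V$: a sequence of forces $u\to v$, each valid at the time performed, in which each vertex of $V\setminus S$ is forced exactly once. $N[i]$ is the closed neighborhood of $i$. The multivariable error polynomial vector $\mathbf{q}^{S'}(t;(\alpha_s)_{s\in S})$ is a vector of polynomials in variables $t$ and $\alpha_s$ ($s\in S$), defined recursively by $\mathbf{q}^{S'}_k=\alpha_k$ if $k\in S$, and $\mathbf{q}^{S'}_k=t\sum_{j\in N[i]\setminus\{k\}}\mathbf{q}^{S'}_j$ if $i$ forces $k$ in $S'$. Each entry is linear in the $\alpha$'s; $[\alpha_s]p$ denotes the coefficient of $\alpha_s$ in $p$ (a polynomial in $t$). The variance polynomial vector is $\mathbf{V}^{S'}_k(t)=\sum_{s\in S}\big([\alpha_s]\mathbf{q}^{S'}_k(t;(\alpha_s)_{s\in S})\big)^2$ for $k\in V$. $\mathcal{S}_{\mathbb{R}}(G)$ is the set of real $|V|\times|V|$ matrices $\mathbf{A}$ with, for $i\ne j$, $\mathbf{A}_{ij}=0$ if $\{i,j\}\notin E$ and $\mathbf{A}_{ij}\neq0$ if $\{i,j\}\in E$, diagonal arbitrary. $\kappa'(\mathbf{A})=\max_{i,j,k}|\mathbf{A}_{ij}/\mathbf{A}_{ik}|$ over triples with $\mathbf{A}_{ij},\mathbf{A}_{ik}\neq0$ (equal to $1$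 for the zero matrix). *)

(* Defs.v *)
(* The notations of [mpoly] clash with those of MathComp-Analysis. *)
From HB Require Import structures.
From mathcomp Require Import all_boot all_order all_algebra.
From mathcomp Require Import -(notations) mpoly.
From mathcomp Require Import all_classical all_reals all_analysis.

Set Implicit Arguments.
Unset Strict Implicit.
Unset Printing Implicit Defensive.

Import Order.TTheory GRing.Theory Num.Theory.
Import numFieldNormedType.Exports.

Local Open Scope ring_scope.

Section Forcing.
Variables (T : finType) (e : rel T).

Definition closed_nbhd (i : T) : {set T} := i |: [set j | e i j]%SET.

(* The last condition says that [v] is the only uncolored neighbor of [u]. *)
Definition can_force (C : {set T}) (u v : T) : bool :=
  (u \in C) && (([set w | e u w] :\: C)%SET == [set v]%SET).

(* Forces [u -> v] are recorded as pairs [(u, v)], in the order in which they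
   are performed.  The forced vertex is uncolored at the time of the force and
   colored afterwards, so each vertex outside [C] is forced exactly once. *)
Fixpoint forcing_chain (C : {set T}) (c : seq (T * T)) : bool :=
  if c is (u, v) :: c' then can_force C u v && forcing_chain (v |: C)%SET c'
  else C == [set: T]%SET.

Definition zero_forcing_set (S : {set T}) : Prop :=
  exists c, forcing_chain S c.

End Forcing.

Notation seed S := {s | s \in S}.

Section ErrorPolynomial.
Variables (R : realType) (T : finType) (e : rel T) (S : {set T}).

(* R[t][alpha_s : s in S]; the variable alpha_s has index [enum_rank s], and
   t is the variable of the coefficient ring {poly R}. *)
Local Notation error_ring := (mpoly #|{: seed S}| {poly R}).

Definition alpha (s : seed S) : error_ring :=
  mpolyX {poly R} (mnm1 (enum_rank s)).

Definition tvar : error_ring := mpolyC #|{: seed S}| 'X.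

Definition coef_alpha (s : seed S) (p : error_ring) : {poly R} :=
  mcoeff (mnm1 (enum_rank s)) p.

Definition seed_poly (k : T) : error_ring :=
  if insub k is Some s then alpha s else 0.

Definition force_poly (q : T -> error_ring) (f : T * T) (k : T) : error_ring :=
  if k == f.2 then tvar * \sum_(j in closed_nbhd e f.1 :\ k) q j else q k.

(* The recursion is run along the chain: when [i] forces [k], all of
   [N[i] \ {k}] is already colored, so the entries it refers to are final.
   The defining equations are [error_poly_seed] and [error_poly_forced]. *)
Definition error_poly (c : seq (T * T)) : T -> error_ring :=
  foldl force_poly seed_poly c.

Definition variance_poly (c : seq (T * T)) (k : T) : {poly R} :=
  \sum_(s : seed S) coef_alpha s (error_poly c k) ^+ 2.

Lemma foldl_force_poly_colored C c q k :
  forcing_chain e C c -> k \in C -> foldl force_poly q c k = q k.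
Proof.
elim: c C q => [|[u v] c IH] C q //= /andP[/andP[_ /eqP uv] cC] kC.
rewrite (IH (v |: C)%SET) ?inE ?kC ?orbT// /force_poly /=.
case: eqP => // kv; have : v \in [set v]%SET by rewrite inE.
by rewrite -uv !inE -kv kC.
Qed.

Lemma error_poly_seed c (s : seed S) :
  forcing_chain e S c -> error_poly c (val s) = alpha s.
Proof.
move=> cS; rewrite /error_poly (foldl_force_poly_colored _ cS) ?(valP s)//.
by rewrite /seed_poly valK.
Qed.

Lemma error_poly_forced c i k :
    forcing_chain e S c -> (i, k) \in c ->
  error_poly c k = tvar * \sum_(j in closed_nbhd e i :\ k) error_poly c j.
Proof.
rewrite /error_poly; pose F q := foldl force_poly q c.
suff H C q : forcing_chain e C c -> (i, k) \in c ->
    F q k = tvar * \sum_(j in closed_nbhd e i :\ k) F q j by exact: H.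
rewrite /F {F}; elim: c C q => [|[u v] c IH] C q //=.
move=> /andP[/andP[uC /eqP uv] cC]; rewrite inE => /predU1P[[-> ->]|]; last first.
  exact: IH cC.
rewrite (foldl_force_poly_colored _ cC) ?setU11// {1}/force_poly eqxx /=.
congr (_ * _); apply: eq_bigr => j; rewrite !inE => /andP[jv juj].
have jC : j \in C.
  case/orP: juj => [/eqP-> //|euj]; apply: contraNT jv => jC.
  have : j \in ([set w | e u w] :\: C)%SET by rewrite !inE jC.
  by rewrite uv inE.
by rewrite (foldl_force_poly_colored _ cC) ?inE ?jC ?orbT// /force_poly (negPf jv).
Qed.

End ErrorPolynomial.

Section Matrices.
Variable R : realType.

(* Rows and columns are indexed by the vertices through [enum_rank]. *)
Definition in_S_R (T : finType) (e : rel T) (A : 'M[R]_#|T|) : Prop :=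
  forall i j : T, i != j -> (A (enum_rank i) (enum_rank j) != 0) = e i j.

(* If [A != 0], the triples with [j = k] contribute the value 1, so starting
   the maximum at 1 only matters for the zero matrix. *)
Definition kappa' n (A : 'M[R]_n) : R :=
  \big[Num.max/1]_(i < n) \big[Num.max/1]_(j < n | A i j != 0)
    \big[Num.max/1]_(k < n | A i k != 0) `|A i j / A i k|.

End Matrices.

Definition mutually_independent (d : measure_display) (Omega : measurableType d)
    (R : realType) (P : probability Omega R) (I : finType)
    (X : I -> {RV P >-> R}) : Prop :=
  forall (J : {set I}) (B : I -> set R), (forall i, measurable (B i)) ->
    P (\bigcap_(i in [set` J]) (X i @^-1` B i))%classic =
    (\prod_(i in J) P (X i @^-1` B i)%classic)%E.

(* Main.v *)
(** Solving row [i] of [A *m x = 0] for [x_k] whenever [i] forces [k] expresses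
    every entry of [x] as a linear combination of the seed entries; applying the
    same combination to the noisy seeds is an unbiased estimate.  Each solving
    step multiplies entries by ratios bounded by [kappa' A], so the coefficients
    are dominated, step by step along the chain, by the coefficients of the error
    polynomials at [t = kappa' A].  Independence makes the covariances vanish, so
    the variance of the error is [eps] times the sum of squared coefficients. *)
Require Import Defs.
From HB Require Import structures.
(* [mpoly] shadows [symmetric]; importing it first restores the usual one. *)
From mathcomp Require Import -(notations) mpoly.
From mathcomp Require Import all_boot all_order all_algebra.
From mathcomp Require Import all_classical all_reals all_analysis.
From mathcomp Require Import measurable_realfun.
From mathcomp Require Import ring lra.

Import Order.TTheory GRing.Theory Num.Theory.
Import numFieldNormedType.Exports.

Local Open Scope ring_scope.

(** * Linear coefficients of the error polynomials *)

Section CoefAlpha.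
Variables (R : realType) (T : finType) (S : {set T}).

(** Base case of the comparison with [recovery], which starts from the same indicator. *)
Lemma coef_alpha_seed_poly (s : seed S) (k : T) :
  coef_alpha s (seed_poly R S k) = (k == val s)%:R.
Proof.
rewrite /coef_alpha /seed_poly; case: insubP => [s' _ <-|kS].
  rewrite /alpha mcoeffX eq_mnm1.
  by rewrite (inj_eq enum_rank_inj) -val_eqE.
rewrite mcoeff0; case: eqP => // ks.
by rewrite ks (valP s) in kS.
Qed.

Lemma coef_alpha_tvarM (s : seed S) p :
  coef_alpha s (tvar R S * p) = 'X * coef_alpha s p.
Proof. exact: mcoeffCM. Qed.

Lemma coef_alpha_sum (s : seed S) (I : Type) (r : seq I) (Q : pred I) F :
  coef_alpha s (\sum_(j <- r | Q j) F j : mpoly #|{: seed S}| {poly R}) =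
  \sum_(j <- r | Q j) coef_alpha s (F j).
Proof. exact: raddf_sum. Qed.

End CoefAlpha.

Section Kappa.
Variables (R : realType) (n : nat) (A : 'M[R]_n).

Lemma kappa'_ge1 : 1 <= kappa' A.
Proof. exact: bigmax_ge_id. Qed.

Lemma ratio_le_kappa' (i j k : 'I_n) : `|A i j / A i k| <= kappa' A.
Proof.
have k0 : 0 <= kappa' A by exact: le_trans kappa'_ge1.
(* Since [0^-1 = 0], a vanishing entry on either side makes the ratio 0, so the bound extends to
   triples outside the range of the maximum. *)
have [Aij|Aij] := eqVneq (A i j) 0; first by rewrite Aij mul0r normr0.
have [Aik|Aik] := eqVneq (A i k) 0; first by rewrite Aik invr0 mulr0 normr0.
apply: (bigmax_sup i) => //; apply: (bigmax_sup j) => //.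
exact: (bigmax_sup k).
Qed.

End Kappa.

(** * Kernel vectors as linear functions of their seed entries *)

Section Recovery.
Variables (R : realType) (T : finType) (e : rel T) (S : {set T}).
Variable A : 'M[R]_#|T|.

Local Notation a i j := (A (enum_rank i) (enum_rank j)).

(* Row [i] of [A *m x = 0], solved for [x_k]. *)
Definition recovery_step (M : T -> seed S -> R) (f : T * T) (k : T) (s : seed S)
    : R :=
  if k == f.2 then - \sum_(j in closed_nbhd e f.1 :\ k) a f.1 j / a f.1 k * M j s
  else M k s.

Definition recovery (c : seq (T * T)) : T -> seed S -> R :=
  foldl recovery_step (fun k s => (k == val s)%:R) c.

(** Both folds run the same recursion, with [t] in place of the ratios on the polynomial side; the
    triangle inequality preserves the domination at each force. *)
Lemma normr_recovery_le c k s :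
  `|recovery c k s| <= (coef_alpha s (error_poly R e S c k)).[kappa' A].
Proof.
rewrite /recovery /error_poly; set M0 := (M in foldl _ M).
have : forall k s, `|M0 k s| <= (coef_alpha s (seed_poly R S k)).[kappa' A].
  move=> k' s'; rewrite coef_alpha_seed_poly normr_nat.
  by case: eqP => _; rewrite ?hornerC ?horner0.
elim: c M0 (seed_poly R S) k s => [|f c IH] M q k s MP //=.
apply: IH => {}k {}s; rewrite /recovery_step /force_poly.
case: ifP => [_|_]; last exact: MP.
rewrite coef_alpha_tvarM coef_alpha_sum hornerM hornerX horner_sum normrN.
rewrite mulr_sumr; apply: le_trans (ler_norm_sum _ _ _) _.
apply: ler_sum => j _; rewrite normrM.
by apply: ler_pM => //; exact: ratio_le_kappa'.
Qed.

Hypothesis A_G : in_S_R e A.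
Variable x : 'cV[R]_#|T|.
Hypothesis Ax0 : A *m x = 0.

Local Notation xv k := (x (enum_rank k) 0).

Lemma solve_row i k : e i k -> i != k ->
  xv k = - \sum_(j in closed_nbhd e i :\ k) a i j / a i k * xv j.
Proof.
move=> eik ik; have Aik : a i k != 0 by rewrite A_G.
have : (A *m x) (enum_rank i) 0 = 0 by rewrite Ax0 mxE.
rewrite mxE (reindex (@enum_rank T)) /=; last first.
  exact/onW_bij/enum_rank_bij.
(* Off the closed neighborhood of [i] the row vanishes, so only that part of the sum survives. *)
rewrite (bigID (mem (closed_nbhd e i))) /= [X in _ + X]big1 ?addr0; last first.
  move=> j; rewrite !inE negb_or => /andP[ji eij].
  have /eqP -> : a i j == 0 by rewrite -[_ == _]negbK A_G 1?eq_sym.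
  by rewrite mul0r.
rewrite (big_setD1 k) ?inE ?eik ?orbT//= => /eqP.
rewrite addr_eq0 => /eqP h.
apply: (mulfI Aik); rewrite h mulrN mulr_sumr; congr (- _).
by apply: eq_bigr => j _; field.
Qed.

Lemma recovery_exact c k : forcing_chain e S c ->
  xv k = \sum_s recovery c k s * xv (val s).
Proof.
rewrite /recovery => cS; set M0 := (M in foldl _ M).
(* The invariant is exactness on the colored set, which the induction lets grow from [S] to all of
   [T]; the index type [seed S] of the coefficients stays fixed. *)
have : forall k, k \in S -> xv k = \sum_s M0 k s * xv (val s).
  move=> k' kS; rewrite /M0 (bigD1 (Sub k' kS : seed S)) //= eqxx mul1r.
  rewrite big1 ?addr0// => s; rewrite -val_eqE /= eq_sym => /negPf->.
  by rewrite mul0r.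
elim: c {1 3}S cS M0 k => [|[u v] c IH] C /=.
  by move=> /eqP-> M k MP; apply: MP; rewrite inE.
move=> /andP[/andP[uC /eqP uv] cC] M k MP; apply: IH cC _ _ _ => {}k.
rewrite /recovery_step /= !inE.
have : v \in [set v]%SET by rewrite inE.
rewrite -uv !inE => /andP[vC euv].
case: (eqVneq k v) => [-> _|kv /= kC]; last by rewrite [LHS]MP.
have unv : u != v by apply: contraNneq vC => <-.
rewrite [LHS](solve_row _ _ euv unv).
under [RHS]eq_bigr do rewrite mulNr mulr_suml.
rewrite sumrN exchange_big /=; congr (- _); apply: eq_bigr => j.
rewrite !inE => /andP[jv juj].
(* As [v] is the only uncolored neighbor of [u], the invariant applies to every other vertex of the
   closed neighborhood. *)
have jC : j \in C.
  case/orP: juj => [/eqP-> //|euj]; apply: contraNT jv => jC.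
  have : j \in ([set w | e u w] :\: C)%SET by rewrite !inE jC.
  by rewrite uv inE.
by rewrite (MP _ jC) mulr_sumr; apply: eq_bigr => s _; rewrite mulrA.
Qed.

End Recovery.

(** * Integrability from finite moments *)

Section Integrability.
Local Open Scope ereal_scope.
Context (d : measure_display) (Omega : measurableType d) (R : realType).
Variable mu : {measure set Omega -> \bar R}.

(* [+oo - +oo = -oo], so a finite integral forces both parts to be finite. *)
Lemma fin_num_integrable (f : Omega -> \bar R) :
  measurable_fun setT f -> \int[mu]_w f w \is a fin_num ->
  mu.-integrable setT f.
Proof.
move=> mf; rewrite integralE.
have p0 : 0 <= \int[mu]_w f^\+ w by exact: integral_ge0.
have n0 : 0 <= \int[mu]_w f^\- w by exact: integral_ge0.
move=> fin; apply/integrableP; split => //.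
under eq_integral do rewrite -/((abse \o f) _) fune_abse.
rewrite ge0_integralD//; [|exact: measurable_funepos|exact: measurable_funeneg].
by move: p0 n0 fin; case: (\int[mu]_w f^\+ w) => [r| |]//;
  case: (\int[mu]_w f^\- w) => [r'| |]//= _ _ _; rewrite ltry.
Qed.

(** The squares of [f + g] and [f - g] are nonnegative, so [f ^ 2 + g ^ 2] dominates the absolute
    value of the product. *)
Lemma integrableM_sqr (f g : Omega -> R) :
  measurable_fun setT f -> measurable_fun setT g ->
  mu.-integrable setT (fun w => (f w * f w)%:E) ->
  mu.-integrable setT (fun w => (g w * g w)%:E) ->
  mu.-integrable setT (fun w => (f w * g w)%:E).
Proof.
move=> mf mg If Ig; apply: le_integrable (integrableD _ If Ig) => //.
  exact/measurable_EFinP/measurable_funM.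
move=> w _ /=; rewrite lee_fin.
have h0 : (0 <= f w * f w + g w * g w)%R by rewrite addr_ge0// -expr2 sqr_ge0.
rewrite (ger0_norm h0) ler_norml; apply/andP; split.
  by have := sqr_ge0 (f w + g w); nra.
by have := sqr_ge0 (f w - g w); nra.
Qed.

End Integrability.

(** * Independence and vanishing covariances *)

Section Independence.
Local Open Scope ereal_scope.
Context (d : measure_display) (Omega : measurableType d) (R : realType).
Variable P : probability Omega R.

(* The joint law is the product of the marginals, so Fubini lets one integrate
   the centered factor [Y - b] first. *)
Lemma indep_integral_centeredM (X Y : {RV P >-> R}) (a b : R) :
  (forall B C : set R, measurable B -> measurable C ->
    P (X @^-1` B `&` Y @^-1` C)%classic =
    P (X @^-1` B)%classic * P (Y @^-1` C)%classic) ->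
  P.-integrable setT (fun w => (Y w - b)%:E) ->
  P.-integrable setT (fun w => ((X w - a) * (Y w - b))%:E) ->
  \int[P]_w (Y w - b)%:E = 0 ->
  \int[P]_w ((X w - a) * (Y w - b))%:E = 0.
Proof.
move=> indep IY IXY EY0.
pose Z w := (X w, Y w).
have mZ : measurable_fun setT Z by exact: measurable_fun_pair.
pose Zm : {RV P >-> (R * R)%type} :=
  MeasurableFun.Pack (MeasurableFun.Class (isMeasurableFun.Build _ _ _ _ _ mZ)).
pose h (z : R * R) : \bar R := ((z.1 - a) * (z.2 - b))%:E.
have mh : measurable_fun setT h.
  by apply/measurable_EFinP/measurable_funM; apply: measurable_funB.
pose mX := distribution P X; pose mY := distribution P Y.
(* Independence is agreement of the two laws on rectangles, which determine the product measure. *)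
have prodE D : measurable D -> (mX \x mY) D = distribution P Zm D.
  by apply: product_measure_unique => B C mB mC; rewrite -indep.
(* Fubini requires integrability under the product law; it is transported from [P] through the joint
   law. *)
have Ih : (mX \x mY).-integrable setT h.
  have /integrableP[_ hoo] : (distribution P Zm).-integrable setT h.
    exact: integrable_pushforward.
  apply/integrableP; split => //.
  rewrite (eq_measure_integral (distribution P Zm))// => D mD _.
  exact: prodE.
transitivity (\int[distribution P Zm]_z h z).
  by rewrite integral_distribution.
rewrite (eq_measure_integral (mX \x mY)); last first.
  by move=> D mD _; exact/esym/prodE.
rewrite -integral12_prod_meas1// /fubini_F /= integral0_eq// => r _ /=.
under eq_integral do rewrite /h/= EFinM.
have mb : measurable_fun setT (fun y : R => (y - b)%:E).
  by apply/measurable_EFinP/measurable_funB.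
rewrite integralZl//; last exact: integrable_pushforward.
by rewrite integral_distribution// EY0 mule0.
Qed.

Lemma mutually_independent_pair (I : finType) (X : I -> {RV P >-> R}) (s t : I) :
  mutually_independent X -> s != t ->
  forall B C : set R, measurable B -> measurable C ->
  P (X s @^-1` B `&` X t @^-1` C)%classic =
  P (X s @^-1` B)%classic * P (X t @^-1` C)%classic.
Proof.
move=> indX st B C mB mC.
pose D i := if i == s then B else C.
have mD i : measurable (D i) by rewrite /D; case: ifP.
have /= := indX [set s; t]%SET D mD.
rewrite big_setU1 ?inE//= big_set1 /D eqxx eq_sym (negPf st) => <-; congr (P _).
apply/seteqP; split => [w [Bw Cw] i|w h].
  by rewrite /= !inE => /orP[]/eqP ->; rewrite ?eqxx// eq_sym (negPf st).
split; first by have := h s; rewrite /= !inE eqxx; exact.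
by have := h t; rewrite /= !inE eqxx orbT eq_sym (negPf st); exact.
Qed.

End Independence.

(** * Mean and variance of a weighted sum of centered variables *)

Section WeightedSum.
Local Open Scope ereal_scope.
Context (d : measure_display) (Omega : measurableType d) (R : realType).
Variables (P : probability Omega R) (I : finType) (X : I -> {RV P >-> R}).
Variables (m : I -> R) (eps : R) (c : I -> R).
Hypothesis EX : forall s, 'E_P[X s] = (m s)%:E.
Hypothesis VX : forall s, 'V_P[X s] = eps%:E.
Hypothesis indX : mutually_independent X.

Let Z s w := (X s w - m s)%R.

Let mZ s : measurable_fun setT (Z s).
Proof. exact: measurable_funB. Qed.

(** Integrability is read off from the mean being a real number. *)
Let integrableX s : P.-integrable setT (EFin \o X s).
Proof.
apply: fin_num_integrable; first exact/measurable_EFinP.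
by have := EX s; rewrite expectation_def => ->.
Qed.

Let integrableZ s : P.-integrable setT (fun w => (Z s w)%:E).
Proof.
have := integrableB measurableT (integrableX s)
  (finite_measure_integrable_cst P (m s) measurableT).
exact.
Qed.

Let integralZ s : \int[P]_w (Z s w)%:E = 0.
Proof.
rewrite integralB_EFin//; last exact: finite_measure_integrable_cst.
rewrite -expectation_def EX integral_cst//= probability_setT mule1.
by rewrite subee.
Qed.

Let integralZ2 s : \int[P]_w (Z s w * Z s w)%:E = eps%:E.
Proof. by rewrite -(VX s) /variance unlock EX unlock. Qed.

Let integrableZZ s t : P.-integrable setT (fun w => (Z s w * Z t w)%:E).
Proof.
by apply: integrableM_sqr => //; apply: fin_num_integrable;
  rewrite ?integralZ2//; exact/measurable_EFinP/measurable_funM.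
Qed.

(** The covariance matrix is [eps] times the identity. *)
Let integralZZ s t :
  \int[P]_w (Z s w * Z t w)%:E = (if s == t then eps else 0%R)%:E.
Proof.
case: eqVneq => [->|st]; first exact: integralZ2.
apply: indep_integral_centeredM.
- exact: mutually_independent_pair.
- exact: integrableZ.
- exact: integrableZZ.
- exact: integralZ.
Qed.

Let f w := (\sum_s c s * Z s w)%R.

Lemma measurable_weighted_sum : measurable_fun setT f.
Proof. by apply: measurable_sum => s; exact: measurable_funM. Qed.

Lemma integrable_weighted_sum : P.-integrable setT (EFin \o f).
Proof.
rewrite (_ : EFin \o f = fun w => \sum_s (c s)%:E * (Z s w)%:E).
  by apply: integrable_sum => // s _; exact: integrableZl.
by apply/funext => w; rewrite /= /f -sumEFin.
Qed.

Lemma expectation_weighted_sum : 'E_P[f] = 0.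
Proof.
rewrite unlock.
transitivity (\int[P]_w \sum_s (c s)%:E * (Z s w)%:E).
  by apply: eq_integral => w _; rewrite /f -sumEFin.
rewrite integral_sum//=; last by move=> s; exact: integrableZl.
by apply: big1 => s _; rewrite integralZl// integralZ mule0.
Qed.

Lemma variance_weighted_sum : 'V_P[f] = ((\sum_s c s ^+ 2) * eps)%:E.
Proof.
rewrite /variance unlock expectation_weighted_sum /= unlock.
(* The square is expanded over pairs of indices, of which only the diagonal ones contribute after
   integration. *)
transitivity (\int[P]_w
    \sum_(p : I * I) (c p.1 * c p.2)%:E * (Z p.1 w * Z p.2 w)%:E).
  apply: eq_integral => w _; rewrite mulrfctE /= subr0 /f.
  rewrite big_distrlr/= pair_big/=.
  by rewrite -sumEFin; apply: eq_bigr => -[s t] _ /=; congr EFin; ring.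
rewrite integral_sum//=; last by move=> p; exact: integrableZl.
under eq_bigr do rewrite integralZl// integralZZ -EFinM.
rewrite sumEFin -(pair_big xpredT xpredT
  (fun s t => c s * c t * (if s == t then eps else 0)))%R /=; congr EFin.
rewrite mulr_suml; apply: eq_bigr => s _.
rewrite (bigD1 s)//= eqxx big1 ?addr0// => t ts.
by rewrite eq_sym (negPf ts) mulr0.
Qed.

End WeightedSum.

Theorem theorem3 (R : realType) (T : finType) (e : rel T)
  (e_sym : symmetric e) (e_irr : irreflexive e)
  (S : {set T}) (S_zf : zero_forcing_set e S)
  (S' : seq (T * T)) (S'_chain : forcing_chain e S S')
  (A : 'M[R]_#|T|) (A_G : in_S_R e A) :
  exists Phi : (seed S -> R) -> 'cV[R]_#|T|,
    forall (eps : R) (x : 'cV[R]_#|T|) (d : measure_display)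
      (Omega : measurableType d) (P : probability Omega R)
      (x' : seed S -> {RV P >-> R}),
      0 <= eps ->
      A *m x = 0 ->
      (forall s : seed S, 'E_P[x' s] = (x (enum_rank (val s)) 0)%:E)%E ->
      (forall s : seed S, 'V_P[x' s] = eps%:E)%E ->
      mutually_independent x' ->
      forall i : T,
        let err := fun w : Omega =>
          x (enum_rank i) 0 - Phi (fun s => x' s w) (enum_rank i) 0 in
        [/\ measurable_fun setT err,
            P.-integrable setT (EFin \o err),
            ('E_P[err] = 0)%E
          & ('V_P[err] <= ((variance_poly R e S S' i).[kappa' A] * eps)%:E)%E].
Proof.
exists (fun y => \col_k \sum_s recovery R T e S A S' (enum_val k) s * y s).
move=> eps x d Omega P x' eps0 Ax0 Ex Vx indx i err.
(* The error is the true entry minus the estimate, hence the sign; it disappears when the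
   coefficients are squared. *)
pose c s := - recovery R T e S A S' i s.
have errE : err = fun w => \sum_s c s * (x' s w - x (enum_rank (val s)) 0).
  apply/funext => w; rewrite /err mxE enum_rankK.
  rewrite (recovery_exact R T e S A A_G x Ax0 S' i S'_chain) -sumrB.
  by apply: eq_bigr => s _; rewrite /c; ring.
rewrite errE; split.
- exact: measurable_weighted_sum.
- exact: integrable_weighted_sum.
- exact: expectation_weighted_sum.
rewrite (variance_weighted_sum _ _ _ _ _ _ _ _ _ Ex Vx indx) lee_fin.
apply: ler_wpM2r => //; rewrite /variance_poly horner_sum.
apply: ler_sum => s _; rewrite horner_exp /c sqrrN -real_normK ?num_real//.
(* This bound is the inequality to be squared, and it also makes the polynomial value nonnegative,
   as squaring requires. *)
have le_s := normr_recovery_le R T e S A S' i s.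
by apply: lerXn2r; rewrite ?nnegrE ?(le_trans _ le_s).
Qed.
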